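(* Let $C_n=\frac{1}{n+1}\binom{2n}{n}$ be the Catalan numbers. For $n\in\mathbb{N}$, $$C_n\equiv\begin{cases}(-1)^{\delta_3^*(n+1)}\pmod 3&\text{if } n\in T^*(01)-1,\\ 0\pmod 3&\text{otherwise.}\end{cases}$$
   Context: For $m\in\mathbb{N}$ with base-$3$ expansion $m=m_0+3m_1+9m_2+\cdots$, let $T^*(01)$ be the set of $m$ such that $m_i\in\{0,1\}$ for all $i\ge1$ (the digit $m_0$ is unrestricted), and let $\delta_3^*(m)$ be the number of indices $i\ge1$ with $m_i=1$. $T^*(01)-1=\{m-1 : m\in T^*(01)\}$. *)

(* Defs.v *)
From HB Require Import structures.
From mathcomp Require Import all_boot all_order all_algebra.

Set Implicit Arguments.
Unset Strict Implicit.
Unset Printing Implicit Defensive.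

Import GRing.Theory.

Definition catalan (n : nat) : nat := 'C(2 * n, n) %/ n.+1.

(* The division in [catalan] is exact. *)
Lemma catalanE (n : nat) : (n.+1 * catalan n)%N = 'C(2 * n, n).
Proof.
rewrite /catalan mulnC divnK //.
have co : coprime n.+1 n by rewrite coprime_sym coprimenS.
rewrite -(Gauss_dvdr _ co); apply/dvdnP; exists 'C(2 * n, n.+1).
by rewrite [RHS]mulnC mul_bin_left mul2n -addnn addnK.
Qed.

Definition digit3 (m i : nat) : nat := (m %/ 3 ^ i) %% 3.

Definition Tstar01 (m : nat) : Prop :=
  forall i : nat, 1 <= i -> digit3 m i \in [:: 0; 1].

(* The shift is taken in [int], since 0 is in T*(01) and the predecessor on
   [nat] truncates. *)
Definition Tstar01_minus1 (k : int) : Prop :=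
  exists2 m : nat, Tstar01 m & k = (m%:Z - 1)%R.

(* Stopping at i <= m loses nothing: later digits vanish, see [digit3_gt]. *)
Definition delta3star (m : nat) : nat :=
  \sum_(1 <= i < m.+1 | digit3 m i == 1) 1.

Lemma digit3_gt (m i : nat) : m < i -> digit3 m i = 0.
Proof.
move=> lt_mi; rewrite /digit3 divn_small //.
exact: ltn_trans lt_mi (ltn_expl i (isT : 1 < 3)).
Qed.

(* Main.v *)
(* Since (1 + x)^3 = 1 + x^3 over F_3, binomial coefficients mod 3 factor
   through base-3 digits (Lucas).  Writing C_n = 'C(2n, n) - 'C(2n, n + 1), this
   gives C_n = 'C(2k, k) mod 3 for k = floor((n + 1) / 3), whose digits are those
   of n + 1 of index >= 1.  Finally 'C(2k, k) is mod 3 the product over the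
   digits d of k of 'C(2d, d), which is 1, -1, 0 for d = 0, 1, 2. *)

Require Import Defs.
From HB Require Import structures.
From mathcomp Require Import all_boot all_order all_algebra.
From mathcomp Require Import zify.

Set Implicit Arguments.
Unset Strict Implicit.
Unset Printing Implicit Defensive.

Import GRing.Theory.

Local Open Scope ring_scope.

Lemma three_F3 : 3%:R = 0 :> 'F_3.
Proof. exact/val_inj. Qed.

(** Coefficient of [x^(k+3)] in [(1 + x)^3 (1 + x)^n]: three uses of Pascal's rule, with the two
    middle terms weighted by 3. *)
Lemma bin_add3 (n k : nat) :
  ('C(n + 3, k + 3))%:R = ('C(n, k + 3))%:R + ('C(n, k))%:R :> 'F_3.
Proof.
have -> : ('C(n + 3, k + 3) =
    'C(n, k + 3) + 'C(n, k) + 3 * ('C(n, k + 2) + 'C(n, k + 1)))%N.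
  rewrite !addn3 addn2 addn1 !binS; lia.
by rewrite natrD natrM three_F3 mul0r addr0 natrD.
Qed.

Lemma bin_add3_small (n d : nat) : (d < 3)%N ->
  ('C(n + 3, d))%:R = ('C(n, d))%:R :> 'F_3.
Proof.
case: d => [|[|[|//]]] _.
- by rewrite !bin0.
- by rewrite !bin1 natrD three_F3 addr0.
have -> : ('C(n + 3, 2) = 'C(n, 2) + 3 * n.+1)%N.
  rewrite addn3 !binS !bin1 !bin0; lia.
by rewrite natrD natrM three_F3 mul0r addr0.
Qed.

(** Raising [a] by one multiplies by [1 + x^3], so the induction on [a] reduces to Pascal's rule for
    ['C(a, c)]. *)
Lemma Lucas3 (a b c d : nat) : (b < 3)%N -> (d < 3)%N ->
  ('C(3 * a + b, 3 * c + d))%:R = ('C(a, c) * 'C(b, d))%:R :> 'F_3.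
Proof.
move=> lt_b lt_d; elim: a c => [|a IHa] [|c].
- by rewrite !muln0 bin0 mul1n.
- by rewrite muln0 bin0n mul0n bin_small //; lia.
- have -> : (3 * a.+1 + b = 3 * a + b + 3)%N by lia.
  have /= := IHa 0%N; rewrite muln0 add0n bin_add3_small // => ->.
  by rewrite !bin0.
have -> : (3 * a.+1 + b = 3 * a + b + 3)%N by lia.
have Ec : (3 * c.+1 + d = 3 * c + d + 3)%N by lia.
by rewrite Ec bin_add3 -Ec !IHa -natrD binS mulnDl.
Qed.

Lemma central_bin3 (a b : nat) : (b < 3)%N ->
  ('C(2 * (3 * a + b), 3 * a + b))%:R
    = ('C(2 * a, a))%:R * ('C(2 * b, b))%:R :> 'F_3.
Proof.
case: b => [|[|[|//]]] _.
- have -> : (2 * (3 * a + 0) = 3 * (2 * a) + 0)%N by lia.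
  by rewrite Lucas3 // natrM.
- have -> : (2 * (3 * a + 1) = 3 * (2 * a) + 2)%N by lia.
  by rewrite Lucas3 // natrM.
(* Doubling the digit 2 carries and leaves 1 below 2, so the left side has the factor
   ['C(1, 2) = 0]; on the right ['C(4, 2) = 6] vanishes too. *)
have -> : (2 * (3 * a + 2) = 3 * (2 * a).+1 + 1)%N by lia.
rewrite Lucas3 // muln0.
by have -> : ('C(2 * 2, 2))%:R = 0 :> 'F_3; [exact/val_inj | rewrite mulr0].
Qed.

Lemma digit3S (k i : nat) : digit3 k i.+1 = digit3 (k %/ 3) i.
Proof. by rewrite /digit3 expnS divnMA. Qed.

(** [N] may exceed the length of [k]: leading zeros contribute ['C(0, 0) = 1]. *)
Lemma central_bin_digits (N k : nat) : (k < 3 ^ N)%N ->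
  ('C(2 * k, k))%:R
    = \prod_(0 <= i < N) ('C(2 * digit3 k i, digit3 k i))%:R :> 'F_3.
Proof.
elim: N k => [|N IHN] k lt_k.
  by rewrite big_geq //; case: k lt_k.
rewrite big_nat_recl //.
under eq_bigr => i _ do rewrite digit3S.
rewrite -IHN ?ltn_divLR -?expnSr // mulrC /digit3 expn0 divn1.
by rewrite -central_bin3 ?ltn_mod // (mulnC 3) -divn_eq.
Qed.

Lemma catalan_bin (n : nat) : (catalan n + 'C(2 * n, n.+1) = 'C(2 * n, n))%N.
Proof.
apply/eqP; rewrite -(eqn_pmul2l (ltn0Sn n)) mulnDr catalanE mul_bin_left.
by rewrite mul2n -addnn addnK mulSn.
Qed.

Lemma catalan_F3 (n : nat) :
  (catalan n)%:R = ('C(2 * (n.+1 %/ 3), n.+1 %/ 3))%:R :> 'F_3.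
Proof.
have /(congr1 (fun x => x%:R : 'F_3)) := catalan_bin n.
rewrite natrD => /(canRL (addrK _)) ->.
have lt_r : (n %% 3 < 3)%N by rewrite ltn_mod.
rewrite (divn_eq n 3) (mulnC _ 3); move: (n %/ 3)%N (n %% 3)%N lt_r => k.
case=> [|[|[|//]]] _.
- have -> : ((3 * k + 0).+1 %/ 3 = k)%N by lia.
  have -> : (2 * (3 * k + 0) = 3 * (2 * k) + 0)%N by lia.
  have -> : ((3 * k + 0).+1 = 3 * k + 1)%N by lia.
  by rewrite !Lucas3 // muln0 subr0 muln1.
- have -> : ((3 * k + 1).+1 %/ 3 = k)%N by lia.
  have -> : (2 * (3 * k + 1) = 3 * (2 * k) + 2)%N by lia.
  have -> : ((3 * k + 1).+1 = 3 * k + 2)%N by lia.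
  by rewrite !Lucas3 // -natrB muln1 ?leq_pmulr // mulnS muln1 addnK.
have -> : ((3 * k + 2).+1 %/ 3 = k.+1)%N by lia.
have -> : (2 * (3 * k + 2) = 3 * (2 * k).+1 + 1)%N by lia.
have -> : ((3 * k + 2).+1 = 3 * k.+1 + 0)%N by lia.
(* Here ['C(2n, n)] vanishes through the carry, leaving [- 'C(2k+1, k+1)]. By symmetry
   ['C(2k+2, k+1)] is twice ['C(2k+1, k+1)], and 2 = -1. *)
rewrite !Lucas3 // muln0 sub0r muln1.
have -> : (2 * k.+1 = (2 * k).+2)%N by lia.
have sym : ('C((2 * k).+1, k) = 'C((2 * k).+1, k.+1))%N.
  by rewrite -bin_sub; [congr 'C(_, _); lia | lia].
rewrite [in RHS]binS sym addnn -muln2 natrM.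
by have -> : 2%:R = -1 :> 'F_3; [exact/val_inj | rewrite mulrN1].
Qed.

Lemma catalan_digits (n : nat) :
  (catalan n)%:R = \prod_(1 <= i < n.+2)
    ('C(2 * digit3 n.+1 i, digit3 n.+1 i))%:R :> 'F_3.
Proof.
(* Taking [n.+1] digits makes the shifted range the one in [delta3star n.+1]. *)
rewrite catalan_F3 (@central_bin_digits n.+1).
  by rewrite big_add1; apply: eq_bigr => i _; rewrite digit3S.
exact: leq_ltn_trans (leq_div _ _) (ltn_expl n.+1 (isT : (1 < 3)%N)).
Qed.

Lemma modz3_F3 (x y : int) : x%:~R = y%:~R :> 'F_3 -> (x = y %[mod 3])%Z.
Proof.
move=> /eqP; rewrite -subr_eq0 -rmorphB /= => xy0.
by apply/eqP; rewrite eqz_mod_dvd (dvdz_pcharf (pchar_Fp (isT : prime 3))).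
Qed.

Lemma Tstar01_minus1E (n : nat) : Tstar01_minus1 n%:Z <-> Tstar01 n.+1.
Proof.
split=> [[m Tm def_n] | T]; last by exists n.+1 => //; lia.
by have <- : m = n.+1 by lia.
Qed.

Local Close Scope ring_scope.

Theorem theorem5p2 (n : nat) :
  (Tstar01_minus1 n%:Z ->
     ((catalan n)%:Z = (-1) ^+ delta3star n.+1 %[mod 3])%Z) /\
  (~ Tstar01_minus1 n%:Z -> ((catalan n)%:Z = 0 %[mod 3])%Z).
Proof.
split=> [/Tstar01_minus1E T | nT]; apply: modz3_F3; rewrite -pmulrn catalan_digits.
  (* The sign becomes a product over digits, compared factorwise: ['C(0, 0) = 1] and
     ['C(2, 1) = 2 = -1]. *)
  rewrite rmorphXn rmorphN1 /delta3star expr_sum [RHS]big_mkcond.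
  apply: eq_big_nat => i /andP[i_gt0 _].
  move: (T i i_gt0); rewrite !inE => /orP[] /eqP -> //.
  exact/val_inj.
(* Digits past [n.+1] are 0, so a finite search decides membership; a failure yields a digit 2,
   whose factor ['C(4, 2)] kills the product. *)
case: (boolP (all (fun i => digit3 n.+1 i \in [:: 0; 1]) (index_iota 1 n.+2))).
  move=> /allP T; case: nT; apply/Tstar01_minus1E => i i_gt0.
  have [le_i | /digit3_gt -> //] := leqP i n.+1.
  by apply: T; rewrite mem_index_iota i_gt0.
case/allPn => i ri di; apply/eqP; rewrite prodf_seq_eq0.
apply/hasP; exists i => //=.
have := ltn_pmod (n.+1 %/ 3 ^ i) (isT : 0 < 3).
rewrite -/(digit3 n.+1 i); move: di; rewrite !inE.
by case: (digit3 n.+1 i) => [|[|[|//]]].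
Qed.
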